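(* Let $\sigma$ be a primitive proper pseudo-unimodular substitution over a finite alphabet $A$, with incidence matrix $M_\sigma$, and let $\alpha\in\mathbb{R}$. Then $e^{2i\pi\alpha}$ is an eigenvalue of $(\Omega_\sigma,S)$ if and only if there exists a row vector $w\in\mathbb{Z}^A$ such that for every generalized eigenvector $v$ of $M_\sigma$ for eigenvalues of modulus $\ge 1$, we have - $wv=\alpha$ if $v$ has sum $1$, - $wv=0$ if $v$ has sum $0$.
   Context: A substitution over a finite alphabet $A$ is a morphism $\sigma:A^*\to A^*$ of the free monoid with $|\sigma(a)|\ge 1$ for all $a\in A$. Its incidence matrix is $M_\sigma=(|\sigma(a)|_b)_{(b,a)\in A^2}$, where $|\sigma(a)|_b$ is the number of occurrences of $b$ in $\sigma(a)$ (row index $b$, column index $a$). $\sigma$ is primitive if some power $M_\sigma^n$, $n\ge1$, has all entries strictly positive. A matrix is pseudo-unimodular if the product of all its non-zero eigenvalues, counted with multiplicity, is $\pm1$; $\sigma$ is pseudo-unimodular if $M_\sigma$ is. $\sigma$ is left-proper (resp. right-proper) if there is a letter $a_0\in A$ such that every $\sigma(a)$, $a\in A$, starts (resp. ends) with $a_0$; it is proper if it is both left-proper and right-proper. A generalized eigenvector of a matrix $M$ for an eigenvalue $\gamma$ is a non-zero complex column vector of $\ker((M-\gamma I)^k)$, with $k$ the algebraic multiplicity of $\gamma$. The sum of a vector is the sum of its coordinates. $S:A^{\mathbb{Z}}\to A^{\mathbb{Z}}$ is the shift $(u_i)_i\mapsto(u_{i+1})_i$, and $\Omega_\sigma$ is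 the smallest non-empty compact subset of $A^{\mathbb{Z}}$ invariant under $\sigma$ and $S$. A complex number $\eta$ of modulus one is an eigenvalue of $(\Omega_\sigma,S)$ if there is a continuous $f:\Omega_\sigma\to\{z\in\mathbb{C}:|z|=1\}$ with $f\circ S=\eta f$. *)

(* Defs.v *)
From HB Require Import structures.
From mathcomp Require Import all_boot all_order all_algebra.
From mathcomp Require Import all_classical all_reals all_analysis.
From mathcomp Require Import complex.

Set Implicit Arguments.
Unset Strict Implicit.
Unset Printing Implicit Defensive.

Import Order.TTheory GRing.Theory Num.Theory.
Import numFieldNormedType.Exports.

Local Open Scope classical_set_scope.
Local Open Scope ring_scope.
Local Open Scope complex_scope.

(* Packing R[i] as a numClosedFieldType is what gives it its norm topology:
   the bare type R[i] has no canonical topology. *)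
Definition Cfield (R : realType) : numClosedFieldType := R[i].

Definition exp_2ipi (R : realType) (alpha : R) : Cfield R :=
  cos (2 * pi * alpha) +i* sin (2 * pi * alpha).

Section Substitutions.
Variable A : finType.
Implicit Type sigma : seq A -> seq A.

Definition substitution sigma :=
  [/\ sigma [::] = [::],
      {morph sigma : s t / s ++ t}
    & forall a, (1 <= size (sigma [:: a]))%N].

Definition left_proper sigma :=
  exists a0, forall a, exists s, sigma [:: a] = a0 :: s.

Definition right_proper sigma :=
  exists a0, forall a, exists s, sigma [:: a] = rcons s a0.

Definition proper_subst sigma := left_proper sigma /\ right_proper sigma.

(* Letters index rows and columns through their rank in enum A. *)
Definition incidence sigma : 'M[int]_#|A| :=
  \matrix_(b, a) (count_mem (enum_val b) (sigma [:: enum_val a]))%:Z.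

Definition primitive_subst sigma :=
  exists2 n : nat, (1 <= n)%N & forall b a, 0 < (incidence sigma ^+ n) b a.

Definition full_shift : topologicalType :=
  {ptws int -> discrete_topology A}.

Definition shiftZ (u : full_shift) : full_shift := fun k => u (k + 1).

(* The image of u is ... sigma(u_-2) sigma(u_-1) . sigma(u_0) sigma(u_1) ...,
   with sigma(u_0) starting at position 0. Its letter at position n >= 0 is the
   n-th letter of sigma(u_0 ... u_n); its letter at position -(n+1) = Negz n is
   the n-th letter from the end of sigma(u_-(n+1) ... u_-1). Since images of
   letters are non-empty these words are long enough, and the default value of
   nth is never used. *)
Definition subst_biinf sigma (u : full_shift) : full_shift :=
  fun k => match k with
  | Posz n => nth (u 0 : A) (sigma (mkseq (fun i => u (Posz i) : A) n.+1)) n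
  | Negz n =>
      nth (u 0 : A)
          (rev (sigma (rev (mkseq (fun i => u (Negz i) : A) n.+1)))) n
  end.

Definition invariant_compact sigma (K : set full_shift) :=
  [/\ K !=set0, compact K, subst_biinf sigma @` K `<=` K & shiftZ @` K `<=` K].

Definition Omega sigma : set full_shift :=
  smallest (invariant_compact sigma) set0.

Definition dynamical_eigenvalue (R : realType) (X : set full_shift)
    (eta : Cfield R) :=
  `|eta| = 1 /\
  exists f : full_shift -> Cfield R,
    [/\ {within X, continuous f},
        forall u, X u -> `|f u| = 1
      & forall u, X u -> f (shiftZ u) = eta * f u].

End Substitutions.

Section Spectrum.
Variables (R : realType) (n : nat).
Implicit Type M : 'M[Cfield R]_n.

(* The eigenvalues of M, repeated according to algebraic multiplicity. *)
Definition spectrum M : seq (Cfield R) :=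
  sval (closed_field_poly_normal (char_poly M)).

Definition pseudo_unimodular M :=
  let p := \prod_(z <- spectrum M | z != 0) z in p = 1 \/ p = -1.

(* The library's eigenvalue is phrased with row vectors; a square matrix and
   its transpose have the same eigenvalues. *)
Definition generalized_eigenvector M (gamma : Cfield R) (v : 'cV[Cfield R]_n) :=
  [/\ eigenvalue M gamma, v != 0
    & (M - gamma%:M) ^+ mup gamma (char_poly M) *m v = 0].

Definition vsum (v : 'cV[Cfield R]_n) : Cfield R := \sum_i v i 0.

End Spectrum.

Definition Cincidence (R : realType) (A : finType) (sigma : seq A -> seq A) :
    'M[Cfield R]_#|A| :=
  map_mx intr (incidence sigma).

(* Main.v *)
Require Import Defs.
From HB Require Import structures.
From mathcomp Require Import all_boot all_order all_algebra.
From mathcomp Require Import all_classical all_reals all_analysis.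
From mathcomp Require Import complex.
From mathcomp Require Import zify ring lra.

Set Implicit Arguments.
Unset Strict Implicit.
Unset Printing Implicit Defensive.

Import Order.TTheory GRing.Theory Num.Theory.
Import numFieldNormedType.Exports.

Local Open Scope classical_set_scope.
Local Open Scope ring_scope.
Local Open Scope complex_scope.

(** Write M for the incidence matrix, e for the row vector (1, ..., 1) and, for
    an integer row w, x = alpha e - w. Since e v is the sum of v, the condition
    on w says that x kills every generalized eigenvector of M for an eigenvalue
    of modulus at least 1. By the spectral decomposition this amounts to
    x M^n -> 0, and the convergence is then geometric, so that the x M^n are even
    summable. The a-th entry of x M^n is the sum of x over the word sigma^n(a),
    which ties this row to the dynamics.

    Properness makes sigma contracting on two-sided sequences: for each window
    around the origin, sigma^n(y) has the same letters there for all y as soon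
    as n is large. Hence sigma has a fixed point u to which all sigma^n(y)
    converge uniformly; u lies in Omega_sigma.

    From an eigenfunction to w. If the letter at position 0 of y is a, then
    sigma^n(S y) is sigma^n(y) shifted by |sigma^n(a)|, and both are close to u.
    An eigenfunction f then gives exp(2 i pi alpha |sigma^n(a)|) -> 1: the row
    alpha e M^n is at distance tending to 0 from an integer row z_n. An integer
    row that tends to 0 vanishes eventually, so z_(n+1) = z_n M for n >= n0.
    Pseudo-unimodularity allows division by M on the image of M^d in the integer
    lattice (by Cayley-Hamilton, because the lowest non-zero coefficient of the
    characteristic polynomial is 1 or -1): z_n0 M^d = w M^(d + n0) for an integer
    row w, and this w satisfies x M^n -> 0.

    From w to an eigenfunction. Summability of the x M^n bounds the sums of x
    over the factors of u: a factor [0, k) of u = sigma(u) is the image of a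
    shorter one, up to part of the image of one letter (Dumont-Thomas). By the
    Gottschalk-Hedlund theorem the function y |-> x_(y_0) is then a coboundary
    F - F o S with F continuous, and exp(- 2 i pi F) is an eigenfunction for
    exp(2 i pi alpha), as x_a differs from alpha by an integer. *)

(** * Sums along two-sided sequences and cutting points *)

Lemma int_step_ind (P : int -> Prop) :
  P 0 -> (forall k, P k -> P (k + 1)) -> (forall k, P (k + 1) -> P k) ->
  forall k, P k.
Proof.
move=> P0 Pup Pdn; case=> n.
  elim: n => [//|n IHn].
  by have := Pup _ IHn; rewrite (_ : Posz n + 1 = Posz n.+1) //; lia.
elim: n => [|n IHn]; apply: Pdn.
  by rewrite (_ : Negz 0 + 1 = 0).
by rewrite (_ : Negz n.+1 + 1 = Negz n) //; lia.
Qed.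

Section Cocycle.
Variable A : Type.

(** The sum of h over the letters of y at positions 0, ..., k - 1, extended to
    k < 0 so that cocycleS holds for all k: the additive cocycle generated by the
    function y |-> h (y 0) of the shift. *)
Definition cocycle (V : zmodType) (h : A -> V) (y : int -> A) (k : int) : V :=
  match k with
  | Posz n => \sum_(i < n) h (y (Posz i))
  | Negz n => - \sum_(i < n.+1) h (y (Negz i))
  end.

Lemma cocycle0 (V : zmodType) (h : A -> V) y : cocycle h y 0 = 0.
Proof. exact: big_ord0. Qed.

Lemma cocycleS (V : zmodType) (h : A -> V) y k :
  cocycle h y (k + 1) = cocycle h y k + h (y k).
Proof.
case: k => [n|[|n]].
- by rewrite (_ : Posz n + 1 = Posz n.+1) /= ?big_ord_recr //; lia.
- by rewrite (_ : Negz 0 + 1 = 0) //= big_ord0 big_ord1 addNr.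
- rewrite (_ : Negz n.+1 + 1 = Negz n) /=; last by lia.
  by rewrite [in RHS]big_ord_recr /= opprD -addrA addNr addr0.
Qed.

Lemma cocycle_shift (V : zmodType) (h : A -> V) y t k :
  cocycle h (fun i => y (i + t)) k = cocycle h y (k + t) - cocycle h y t.
Proof.
elim/int_step_ind: k => [|k IHk|k IHk].
- by rewrite cocycle0 add0r subrr.
- by rewrite cocycleS IHk (addrAC k) cocycleS addrAC.
- apply: (addIr (h (y (k + t)))); rewrite -[LHS](cocycleS h (fun i => y (i + t))).
  by rewrite IHk (addrAC k) cocycleS addrAC.
Qed.

Definition weight (V : zmodType) (h : A -> V) (s : seq A) : V :=
  \sum_(c <- s) h c.

Lemma weight_cat (V : zmodType) (h : A -> V) s t :
  weight h (s ++ t) = weight h s + weight h t.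
Proof. exact: big_cat. Qed.

End Cocycle.

Section Subst.
Variable A : finType.
Implicit Types (sigma tau : seq A -> seq A) (y : int -> A).

Definition letter_size sigma (a : A) : int := (size (sigma [:: a]))%:Z.

(** The position in sigma(y) where the image of the letter y_j begins. *)
Definition cutpt sigma y (j : int) : int := cocycle (letter_size sigma) y j.

Lemma cutpt0 sigma y : cutpt sigma y 0 = 0.
Proof. exact: cocycle0. Qed.

Lemma cutptS sigma y (j : int) :
  cutpt sigma y (j + 1) = cutpt sigma y j + (size (sigma [:: y j]))%:Z.
Proof. exact: cocycleS. Qed.

Lemma weight_subst sigma (V : zmodType) (h : A -> V) s : substitution sigma ->
  weight h (sigma s) = weight (fun a => weight h (sigma [:: a])) s.
Proof.
case=> s0 sD _; elim: s => [|a s IHs].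
  by rewrite s0 /weight !big_nil.
by rewrite -cat1s sD !weight_cat IHs [weight _ [:: a]]/weight big_seq1.
Qed.

Lemma weight_letter_size sigma s : substitution sigma ->
  weight (letter_size sigma) s = (size (sigma s))%:Z.
Proof.
case=> s0 sD _; elim: s => [|a s IHs].
  by rewrite s0 /weight big_nil.
by rewrite -cat1s sD weight_cat IHs size_cat PoszD /weight big_seq1.
Qed.

Lemma size_subst sigma s : substitution sigma -> (size s <= size (sigma s))%N.
Proof.
case=> s0 sD s1; elim: s => [|a s IHs]; first by [].
by rewrite -cat1s sD !size_cat leq_add // s1.
Qed.

Lemma substitution_comp sigma tau :
  substitution sigma -> substitution tau -> substitution (sigma \o tau).
Proof.
move=> Hs Ht; case: (Hs) => s0 sD _; case: (Ht) => t0 tD t1; split=> /=.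
- by rewrite t0.
- by move=> s t /=; rewrite tD sD.
- by move=> a; apply: leq_trans (t1 a) (size_subst _ Hs).
Qed.

Lemma substitution_iter sigma n :
  substitution sigma -> substitution (iter n sigma).
Proof.
by move=> Hs; elim: n => [|n IHn]; [split | exact: substitution_comp].
Qed.

Lemma cutpt_Posz sigma y n : substitution sigma ->
  cutpt sigma y (Posz n) =
  (size (sigma (mkseq (fun i => y (Posz i)) n)))%:Z.
Proof.
move=> Hs; rewrite -weight_letter_size // /cutpt /= /weight.
by rewrite big_map -val_enum_ord big_map big_enum.
Qed.

Lemma cutpt_Negz sigma y n : substitution sigma ->
  cutpt sigma y (Negz n) =
  - (size (sigma (rev (mkseq (fun i => y (Negz i)) n.+1))))%:Z.
Proof.
move=> Hs; rewrite -weight_letter_size // /cutpt /= /weight.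
rewrite (perm_big (mkseq (fun i => y (Negz i)) n.+1)) ?perm_rev //.
by rewrite big_map -val_enum_ord big_map big_enum.
Qed.

Lemma mkseqD (T : Type) (f : nat -> T) m n :
  mkseq f (m + n) = mkseq f m ++ mkseq (fun i => f (m + i)%N) n.
Proof.
by rewrite /mkseq iotaD map_cat add0n -{2}[m]addn0 iotaDl -map_comp.
Qed.

(** This turns the definition of the image, given by two formulas on either side
    of the origin, into one uniform in the sign of j; it determines the image,
    because every position lies in the image of some letter (cutpt_cover). *)
Lemma subst_biinfE sigma y (j : int) (i : nat) : substitution sigma ->
  (i < size (sigma [:: y j]))%N ->
  subst_biinf sigma y (cutpt sigma y j + i%:Z) =
  nth (y 0) (sigma [:: y j]) i.
Proof.
move=> Hs; case: (Hs) => s0 sD s1; case: j => n lt_i.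
- rewrite cutpt_Posz //.
  set v := mkseq _ n; set K := (size (sigma v) + i)%N.
  rewrite -PoszD -/K /=.
  have le_nK : (n <= K)%N.
    apply: leq_trans (leq_addr _ _).
    by rewrite -{1}(size_mkseq (fun i => y (Posz i)) n) size_subst.
  rewrite -(subnKC le_nK) -addnS mkseqD -addn1 addnC mkseqD !sD.
  rewrite -/v nth_cat subnKC // ltnNge /K leq_addr /= addKn /=.
  rewrite (_ : mkseq (fun i0 : nat => y (n + i0)%N) 1 = [:: y n]).
    by rewrite nth_cat lt_i.
  by rewrite /mkseq /= addn0.
- rewrite cutpt_Negz // mkseqS rev_rcons -cat1s sD size_cat PoszD.
  set v := sigma (rev (mkseq _ n)); set a := sigma [:: _].
  pose m := (size v + (size a - i.+1))%N.
  rewrite [- _ + _](_ : _ = Negz m); last by rewrite /m; move: lt_i; rewrite -/a; lia.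
  have le_nm : (n <= m)%N.
    apply: leq_trans (leq_addr _ _).
    by rewrite -{1}(size_mkseq (fun i => y (Negz i)) n) -size_rev size_subst.
  rewrite /= -(subnKC le_nm) -addnS mkseqD -addn1 addnC mkseqD !rev_cat.
  rewrite !sD !rev_cat -/v catA subnKC //.
  have -> : mkseq (fun i0 : nat => y (Negz (n + i0))) 1 = [:: y (Negz n)].
    by rewrite /mkseq /= addn0.
  rewrite -/a -catA nth_cat size_rev ltnNge leq_addr /= addKn.
  rewrite nth_cat size_rev (_ : (_ < size a)%N); last by move: lt_i; rewrite -/a; lia.
  rewrite nth_rev; last by move: lt_i; rewrite -/a; lia.
  by congr nth; move: lt_i; rewrite -/a; lia.
Qed.

Lemma cutpt_ge sigma y (j : int) : substitution sigma -> 0 <= j ->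
  j <= cutpt sigma y j.
Proof.
move=> Hs; case: j => n // _; rewrite cutpt_Posz // lez_nat.
by rewrite -{1}(size_mkseq (fun i => y (Posz i)) n) size_subst.
Qed.

Lemma cutpt_le sigma y (j : int) : substitution sigma -> j <= 0 ->
  cutpt sigma y j <= j.
Proof.
move=> Hs; case: j => n.
  by case: n => // _; rewrite cutpt0.
move=> _; rewrite cutpt_Negz //.
have := size_subst (rev (mkseq (fun i => y (Negz i)) n.+1)) Hs.
by rewrite size_rev size_mkseq; lia.
Qed.

(** The bounds on j come from images of letters being non-empty; they keep
    repeated desubstitution of a position under control. *)
Lemma cutpt_cover sigma y (k : int) : substitution sigma ->
  exists (j : int) (i : nat), [/\ (i < size (sigma [:: y j]))%N,
    k = cutpt sigma y j + i%:Z
    & (0 <= j <= k) || (k <= j < 0)].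
Proof.
move=> Hs; have [_ _ s1] := Hs.
have cS := cutptS sigma y.
have cge := @cutpt_ge _ y _ Hs; have cle := @cutpt_le _ y _ Hs.
suff [j [i [lt_i ->]]] : exists j i, (i < size (sigma [:: y j]))%N /\
    k = cutpt sigma y j + i%:Z.
  exists j, i; split=> //; have := cS j.
  case: (lerP 0 j) => j0; first by have := cge _ j0; lia.
  have j1 : j + 1 <= 0 by lia.
  have := cle _ j1; have := cle _ (ltW j0). lia.
elim/int_step_ind: k => [|k [j [i [lt_i ->]]]|k [j [i [lt_i Ek]]]].
- exists 0, 0%N; split; first exact: s1.
  by have := cge 0 (lexx _); have := cle 0 (lexx _); lia.
- case: (ltnP i.+1 (size (sigma [:: y j]))) => Hi.
    by exists j, i.+1; split; lia.
  exists (j + 1), 0%N; split; first exact: s1.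
  by rewrite cS; lia.
- case: i lt_i Ek => [|i] lt_i Ek; last by exists j, i; split; lia.
  exists (j - 1), (size (sigma [:: y (j - 1)])).-1.
  have := s1 (y (j - 1)); have := cS (j - 1).
  by rewrite subrK; split; lia.
Qed.

(** A sum over sigma(y) up to a position inside the image of y_j is a sum over y
    up to j, with each letter weighted by its image, plus an incomplete image:
    one step of the Dumont-Thomas decomposition. *)
Lemma cocycle_subst sigma y (V : zmodType) (h : A -> V) j (i : nat) :
  substitution sigma -> (i <= size (sigma [:: y j]))%N ->
  cocycle h (subst_biinf sigma y) (cutpt sigma y j + i%:Z) =
  cocycle (fun a => weight h (sigma [:: a])) y j +
  weight h (take i (sigma [:: y j])).
Proof.
move=> Hs; pose c := cutpt sigma y; have cS := cutptS sigma y.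
pose g := cocycle (fun a => weight h (sigma [:: a])) y.
have step j' i' : (i' <= size (sigma [:: y j']))%N ->
    cocycle h (subst_biinf sigma y) (c j' + i'%:Z) =
    cocycle h (subst_biinf sigma y) (c j') +
    weight h (take i' (sigma [:: y j'])).
  elim: i' => [|i' IH] Hi; first by rewrite take0 /weight big_nil !addr0.
  rewrite -addn1 PoszD addrA cocycleS IH 1?ltnW // subst_biinfE //.
  by rewrite addn1 (take_nth (y 0)) // -cats1 weight_cat /weight big_seq1 addrA.
have stepS j' : cocycle h (subst_biinf sigma y) (c (j' + 1)) =
    cocycle h (subst_biinf sigma y) (c j') + weight h (sigma [:: y j']).
  by rewrite /c cS step // take_size.
move=> Hi; rewrite step //; congr (_ + _); rewrite -/c -/g.
elim/int_step_ind: j {i Hi} => [|j IH|j IH].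
- by rewrite /c /g cutpt0 !cocycle0.
- by rewrite stepS IH /g cocycleS.
- by apply: (addIr (weight h (sigma [:: y j]))); rewrite -stepS IH /g cocycleS.
Qed.

Lemma subst_biinf_comp sigma tau y : substitution sigma -> substitution tau ->
  subst_biinf (sigma \o tau) y = subst_biinf sigma (subst_biinf tau y).
Proof.
move=> Hs Ht; apply/funext => k.
have [m [q [lt_q -> _]]] := cutpt_cover (subst_biinf tau y) k Hs.
have [j [p [lt_p Em _]]] := cutpt_cover y m Ht.
rewrite [RHS]subst_biinfE // {1}Em /cutpt cocycle_subst //; last exact: ltnW.
have Ez : subst_biinf tau y m = nth (y 0) (tau [:: y j]) p.
  by rewrite Em subst_biinfE.
rewrite Ez in lt_q *; set z := nth _ _ _ in lt_q *.
have [_ sD _] := Hs.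
rewrite weight_letter_size // -addrA -PoszD.
have Es : sigma (tau [:: y j]) = sigma (take p (tau [:: y j])) ++
    sigma [:: z] ++ sigma (drop p.+1 (tau [:: y j])).
  by rewrite -!sD /= -{1}(cat_take_drop p (tau [:: y j])) (drop_nth (y 0)).
rewrite (_ : cocycle _ y j = cutpt (sigma \o tau) y j).
  rewrite subst_biinfE /=; first last.
  - by rewrite Es !size_cat ltn_add2l ltn_addr.
  - exact: substitution_comp.
  rewrite Es nth_cat ltnNge leq_addr /= addKn nth_cat lt_q.
  exact: set_nth_default.
rewrite /cutpt; congr (cocycle _ y j); apply/funext => a; exact: weight_letter_size.
Qed.

Lemma subst_biinf_iter sigma n y : substitution sigma ->
  subst_biinf (iter n sigma) y = iter n (subst_biinf sigma) y.
Proof.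
move=> Hs; elim: n => [|n IHn] /=; last first.
  by rewrite -IHn -subst_biinf_comp //; exact: substitution_iter.
have Hi : substitution (fun s : seq A => s) by split.
apply/funext => k; have [j [i [/= lt_i -> _]]] := cutpt_cover y k Hi.
rewrite subst_biinfE //=; case: i lt_i => [|//] _ /=.
rewrite addr0; congr (y _); elim/int_step_ind: j => [|j IHj|j IHj].
- by rewrite cutpt0.
- by rewrite cutptS -IHj.
- by apply: (addIr 1); rewrite IHj cutptS.
Qed.

Lemma subst_biinf_shift sigma y (t k : int) : substitution sigma ->
  subst_biinf sigma (fun i => y (i + t)) k =
  subst_biinf sigma y (k + cutpt sigma y t).
Proof.
move=> Hs; have [j [i [lt_i -> _]]] := cutpt_cover (fun i => y (i + t)) k Hs.
rewrite subst_biinfE // [cutpt _ (fun=> _) _]cocycle_shift -!/(cutpt _ _ _).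
rewrite addrAC subrK subst_biinfE //; exact: set_nth_default.
Qed.

Lemma cutpt1 sigma y : cutpt sigma y 1 = (size (sigma [:: y 0]))%:Z.
Proof. by rewrite -(add0r 1) cutptS cutpt0 add0r. Qed.
End Subst.

(** * Powers of a substitution and its two-sided fixed point *)

Section Iterates.
Variable A : finType.
Implicit Types (sigma tau : seq A -> seq A) (y u : int -> A).

Lemma weight_count (V : zmodType) (h : A -> V) s :
  weight h s = \sum_(c : A) h c *+ count_mem c s.
Proof.
elim: s => [|a s IHs].
  by rewrite /weight big_nil big1 // => c _; rewrite mulr0n.
rewrite -cat1s weight_cat IHs {1}/weight big_seq1.
under [RHS]eq_bigr do rewrite count_cat mulrnDr.
rewrite big_split /=; congr (_ + _); rewrite (bigD1 a) //= eqxx big1 ?addr0 //.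
by move=> c /negPf; rewrite eq_sym => ->.
Qed.

Lemma sum_enum_val (V : nmodType) (F : A -> V) :
  \sum_(c : A) F c = \sum_(i < #|A|) F (enum_val i).
Proof. by rewrite (reindex (@enum_val A A)) //; apply/onW_bij/enum_val_bij. Qed.

Lemma row_incidence (K : pzRingType) (h : A -> K) sigma :
  (\row_i h (enum_val i)) *m map_mx intr (incidence sigma) =
  \row_i weight h (sigma [:: enum_val i]).
Proof.
apply/rowP => i; rewrite !mxE weight_count sum_enum_val.
apply: eq_bigr => j _; rewrite !mxE -pmulrn mulr_natr //.
Qed.

Lemma count_weight (b : A) s :
  (count_mem b s)%:Z = weight (fun c => (c == b)%:Z) s.
Proof.
elim: s => [|a s IHs]; first by rewrite /weight big_nil.
by rewrite /= PoszD IHs /weight big_cons.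
Qed.

(** Being positive becomes a statement on the words sigma^n(a), which is how
    primitivity is used. *)
Lemma incidence_iter sigma n : substitution sigma ->
  incidence (iter n sigma) = incidence sigma ^+ n.
Proof.
move=> Hs; elim: n => [|n IHn].
  rewrite expr0; apply/matrixP => b a; rewrite !mxE /= addn0.
  by rewrite (inj_eq enum_val_inj) eq_sym; case: (_ == _).
rewrite exprS -IHn; apply/matrixP => b a; rewrite !mxE /= count_weight.
rewrite weight_subst // weight_count sum_enum_val; apply: eq_bigr => c _.
by rewrite !mxE -count_weight -mulr_natr natz.
Qed.

Lemma primitive_mem sigma : substitution sigma -> primitive_subst sigma ->
  exists2 p : nat, (0 < p)%N & forall a b, b \in iter p sigma [:: a].
Proof.
move=> Hs [p p0 Hp]; exists p => // a b.
have := Hp (enum_rank b) (enum_rank a).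
by rewrite -incidence_iter // mxE !enum_rankK ltz_nat -has_count has_pred1.
Qed.

Lemma size_iter_subst sigma m n s : substitution sigma -> (n <= m)%N ->
  (size (iter n sigma s) <= size (iter m sigma s))%N.
Proof.
move=> Hs /subnK <-; rewrite iterD; apply: size_subst.
exact: substitution_iter.
Qed.

(** Once every sigma^p(a) contains all letters, sigma^p at least doubles
    lengths. For a one-letter alphabet lengths may stay equal to 1. *)
Lemma subst_growth sigma N : substitution sigma -> primitive_subst sigma ->
  (1 < #|A|)%N ->
  exists n, forall m a, (n <= m)%N -> (N <= size (iter m sigma [:: a]))%N.
Proof.
move=> Hs Hp A1; have [p p0 memp] := primitive_mem Hs Hp.
have Ht : substitution (iter p sigma) by exact: substitution_iter.
have dbl s : (2 * size s <= size (iter p sigma s))%N.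
  have [t0 tD _] := Ht.
  elim: s => [//|a s IHs]; rewrite -cat1s tD !size_cat mulnDr leq_add //.
  rewrite muln1; apply: leq_trans A1 _; rewrite cardE.
  by apply: uniq_leq_size (enum_uniq _) _ => b _; exact: memp.
exists (N * p)%N => m a /size_iter_subst-/(_ _ [:: a] Hs); apply: leq_trans.
rewrite iterM; apply: ltnW; elim: N => [//|N IHN] /=.
by apply: leq_trans (dbl _); lia.
Qed.

(** The window is [-N, N), symmetric for the two letters at positions -1 and 0
    that determine the image of a sequence near the origin. *)
Definition agree N (y y' : int -> A) :=
  forall k : int, - N%:Z <= k < N%:Z -> y k = y' k.

Lemma agree_trans N (y2 y1 y3 : int -> A) :
  agree N y1 y2 -> agree N y2 y3 -> agree N y1 y3.
Proof. by move=> H12 H23 k Hk; rewrite H12 ?H23. Qed.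

Lemma agree_sym N (y1 y2 : int -> A) : agree N y1 y2 -> agree N y2 y1.
Proof. by move=> H k Hk; rewrite H. Qed.

Lemma agree_subst sigma N y y' :
  agree N y y' -> agree N (subst_biinf sigma y) (subst_biinf sigma y').
Proof.
move=> H; have H0 : (0 < N)%N -> y 0 = y' 0 by move=> N0; apply: H; lia.
case=> n Hn /=; rewrite (H0 _) //; try lia.
- congr (nth _ (sigma _) _); apply/eq_in_map => i.
  by rewrite mem_iota => Hi; apply: H; lia.
- congr (nth _ (rev (sigma (rev _))) _); apply/eq_in_map => i.
  by rewrite mem_iota => Hi; apply: H; lia.
Qed.

(** Properness fixes the letters of sigma(y) at positions -1 and 0, and their
    images under sigma^m fill a long window around the origin. *)
Lemma subst_contract sigma N :
  substitution sigma -> primitive_subst sigma -> proper_subst sigma ->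
  exists n, forall m y y', (n <= m)%N ->
    agree N (iter m (subst_biinf sigma) y) (iter m (subst_biinf sigma) y').
Proof.
move=> Hs Hp [[a0 Ha] [b0 Hb]].
have [A1|/card_le1_eqP A1] := ltnP 1 #|A|; last first.
  by exists 0%N => m y y' _ k _; apply: A1.
have [n Hn] := subst_growth N Hs Hp A1.
exists n.+1 => -[//|m] y y' lenm; rewrite !iterSr.
set tau := iter m sigma; have Ht : substitution tau by exact: substitution_iter.
have first_letter z : subst_biinf sigma z 0 = a0.
  have [s Es] := Ha (z 0).
  have := @subst_biinfE _ sigma z 0 0%N Hs; rewrite cutpt0 addr0 Es.
  exact.
have last_letter z : subst_biinf sigma z (-1) = b0.
  have [s Es] := Hb (z (-1)).
  have := @subst_biinfE _ sigma z (-1) (size s) Hs.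
  have := cutptS sigma z (-1); rewrite (_ : -1 + 1 = 0) // cutpt0 Es size_rcons.
  move=> Ec; rewrite (_ : _ + _ = -1); last by lia.
  by rewrite nth_rcons ltnn eqxx => ->.
(* Near the origin the image only depends on the letters at positions -1 and
   0, which properness has just determined. *)
have value (z : int -> A) (k : int) : - N%:Z <= k < N%:Z -> z 0 = a0 -> z (-1) = b0 ->
    subst_biinf tau z k =
    if 0 <= k then nth a0 (tau [:: a0]) `|k|%N
    else nth a0 (tau [:: b0]) (size (tau [:: b0]) - `|k|)%N.
  move=> Hk z0 z1; have := Hn m a0 lenm; have := Hn m b0 lenm.
  rewrite -/tau => Nb Na; case: ifP => k0.
    have := @subst_biinfE _ tau z 0 `|k|%N Ht; rewrite cutpt0 add0r z0.
    by rewrite (_ : Posz `|k|%N = k); [apply; lia | lia].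
  have := @subst_biinfE _ tau z (-1) (size (tau [:: b0]) - `|k|)%N Ht.
  have := cutptS tau z (-1); rewrite (_ : -1 + 1 = 0) // cutpt0 z0 z1 => Ec.
  by rewrite (_ : _ + _ = k); [apply; lia | lia].
by move=> k Hk; rewrite -!subst_biinf_iter // !value.
Qed.

Lemma biinf_fixed_point sigma :
  substitution sigma -> primitive_subst sigma -> proper_subst sigma ->
  exists u, subst_biinf sigma u = u /\
    forall N, exists n, forall m y, (n <= m)%N ->
      agree N (iter m (subst_biinf sigma) y) u.
Proof.
move=> Hs Hp Hpr; pose S := subst_biinf sigma.
have [nn Hnn] := choice (fun N => subst_contract N Hs Hp Hpr).
have [[a0 _] _] := Hpr; pose y0 : int -> A := fun=> a0.
pose u k := iter (nn `|k|.+1) S y0 k.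
have conv N m y : (nn N <= m)%N -> agree N (iter m S y) u.
  move=> lem k Hk; rewrite /u; set n' := nn _.
  have [le|/ltnW le] := leqP n' m.
    rewrite -(subnKC le) iterD; apply: (Hnn `|k|.+1) => //; lia.
  by rewrite -(subnKC le) iterD; apply: (Hnn N).
exists u; split; last by move=> N; exists (nn N) => m y; apply: conv.
apply/funext => k; pose N := `|k|.+1; have Hk : - N%:Z <= k < N%:Z by lia.
have c1 := conv N _ y0 (leqnn _); have c2 := conv N _ y0 (leqnSn _).
by rewrite -(c2 k Hk) /= -(agree_subst sigma c1 Hk).
Qed.

Section FixedPoint.
Variables (sigma : seq A -> seq A) (u : int -> A).
Hypotheses (Hs : substitution sigma) (Hp : primitive_subst sigma).
Hypothesis u_fix : subst_biinf sigma u = u.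
Hypothesis u_lim : forall N, exists n, forall m y, (n <= m)%N ->
  agree N (iter m (subst_biinf sigma) y) u.

Lemma iter_fixed n : iter n (subst_biinf sigma) u = u.
Proof. by elim: n => [//|n IHn] /=; rewrite IHn. Qed.

Lemma fixed_point_letter a : exists k : nat, u k = a.
Proof.
have [p _ memp] := primitive_mem Hs Hp; exists (index a (iter p sigma [:: u 0])).
have Ht := substitution_iter p Hs.
have lt : (index a (iter p sigma [:: u 0]) < size (iter p sigma [:: u 0]))%N.
  by rewrite index_mem.
have := subst_biinfE Ht lt; rewrite cutpt0 add0r subst_biinf_iter // iter_fixed.
by move=> ->; rewrite nth_index.
Qed.

(** Every cutting point of level n of u is an occurrence of the central window
    of u, because the images sigma^n(y) all agree there; the gaps between these
    cutting points are at most the largest length of a sigma^n(a). *)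
Lemma fixed_point_recurrent N : exists L : nat, forall k : int,
  exists t : int, k <= t <= k + L%:Z /\ agree N (fun i => u (i + t)) u.
Proof.
have [n Hn] := u_lim N; set tau := iter n sigma.
have Ht : substitution tau by exact: substitution_iter.
exists (\max_a size (tau [:: a])) => k.
have [j [i [lt_i -> _]]] := cutpt_cover u k Ht.
exists (cutpt tau u (j + 1)); split.
  by rewrite cutptS; have := @leq_bigmax _ (fun a => size (tau [:: a])) (u j); lia.
apply: agree_trans (Hn n (fun i => u (i + (j + 1))) (leqnn _)).
move=> k' _; rewrite -subst_biinf_iter // -/tau subst_biinf_shift //.
by rewrite subst_biinf_iter // iter_fixed.
Qed.

End FixedPoint.
End Iterates.

(** * Topology of the full shift and the set Omega *)

Section ShiftTopology.
Variable A : finType.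
Implicit Types u y : full_shift A.

Definition cylinder u (N : nat) : set (full_shift A) := [set y | agree N u y].

Lemma nbhs_coordinate u (k : int) : nbhs u [set y : full_shift A | y k = u k].
Proof.
have := @proj_continuous int (fun=> discrete_topology A) k u.
by move/(_ [set u k]); apply; rewrite /= nbhs_principalE; apply/principal_filterP.
Qed.

Lemma nbhs_cylinder u N : nbhs u (cylinder u N).
Proof.
elim: N => [|N IHN]; first by apply: filterS filterT => y _ k; lia.
have Hp := nbhs_coordinate u N%:Z; have Hn := nbhs_coordinate u (Negz N).
apply: filterS (filterI IHN (filterI Hp Hn)) => y [HN [/= Ep En]] k Hk.
have [->//|kp] := eqVneq k N%:Z; have [->//|kn] := eqVneq k (Negz N).
by apply: HN; lia.
Qed.

(** Closedness and continuity on the full shift become comparisons of windows. *)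
Lemma nbhs_cylinderP u (U : set (full_shift A)) :
  nbhs u U <-> exists N, cylinder u N `<=` U.
Proof.
split; last by move=> [N] HN; apply: filterS HN (nbhs_cylinder u N).
pose F := filter_from setT (cylinder u).
have FF : Filter F.
  apply: filter_from_filter; first by exists 0%N.
  move=> M N _ _; exists (maxn M N) => // y Hy.
  by split=> k Hk; apply: Hy; lia.
suff cF : F --> u by move/cF => [N _ HN]; exists N.
apply/cvg_sup => k V; rewrite (@nbhsE (initial_topology (fun f : int -> discrete_topology A => f k))) => -[W [[B oB <-] Bu] BV].
exists `|k|.+1 => // y Hy; apply: BV => /=.
by rewrite -(Hy k) //; lia.
Qed.

Lemma full_shift_compact : compact [set: full_shift A].
Proof.
have := @tychonoff int (fun=> discrete_topology A) (fun=> setT).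
rewrite (_ : [set f | _] = setT); last by apply/seteqP; split.
by apply => _; apply: finite_compact; exact: finite_finset.
Qed.

Lemma full_shift_hausdorff : hausdorff_space (full_shift A).
Proof. by apply: hausdorff_product => k; exact: discrete_hausdorff. Qed.

Lemma closed_cylinderP (K : set (full_shift A)) :
  (forall u, (forall N, exists2 y, K y & agree N u y) -> K u) -> closed K.
Proof.
move=> HK u clu; apply: HK => N.
by have [y [Ky Hy]] := clu _ (nbhs_cylinder u N); exists y.
Qed.

Lemma closed_cylinder (K : set (full_shift A)) u : closed K ->
  (forall N, exists2 y, K y & agree N u y) -> K u.
Proof.
move=> clK Hu; apply: clK => U /nbhs_cylinderP [N HN].
by have [y Ky Hy] := Hu N; exists y; split=> //; exact: HN.
Qed.

Section Hull.
Variables (sigma : seq A -> seq A) (u : full_shift A).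
Hypothesis Hs : substitution sigma.
Hypothesis u_fix : subst_biinf sigma u = u.
Hypothesis u_lim : forall N, exists n, forall m y, (n <= m)%N ->
  agree N (iter m (subst_biinf sigma) y) u.

(** The orbit closure of u, in combinatorial form. *)
Definition hull : set (full_shift A) :=
  [set y | forall N, exists t : int, agree N y (fun i => u (i + t))].

Lemma hull_invariant_compact : invariant_compact sigma hull.
Proof.
split.
- by exists u => N; exists 0 => k _; rewrite addr0.
- apply: (subclosed_compact _ full_shift_compact) => //.
  apply: closed_cylinderP => y Hy N; have [z Hz yz] := Hy N.
  by have [t Ht] := Hz N; exists t; exact: agree_trans Ht.
- move=> _ [y Hy <-] N; have [t Ht] := Hy N; exists (cutpt sigma u t).
  apply: agree_trans (agree_subst sigma Ht) _ => k _.
  by rewrite subst_biinf_shift // u_fix.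
- move=> _ [y Hy <-] N; have [t Ht] := Hy N.+1; exists (t + 1) => k Hk.
  by rewrite /shiftZ Ht ?addrA 1?(addrAC k) //; lia.
Qed.

Lemma Omega_hull : Omega sigma `<=` hull.
Proof. by apply: smallest_sub => //; exact: hull_invariant_compact. Qed.

Lemma Omega_subst y : Omega sigma y -> Omega sigma (subst_biinf sigma y).
Proof.
move=> Hy K HK; have [[_ _ sK _] _] := HK; apply: sK; exists y => //; exact: Hy.
Qed.

Lemma Omega_shift y : Omega sigma y -> Omega sigma (shiftZ y).
Proof.
move=> Hy K HK; have [[_ _ _ sK] _] := HK; apply: sK; exists y => //; exact: Hy.
Qed.

(** Any invariant compact set contains some y, hence all sigma^n(y), and these
    converge to u. *)
Lemma Omega_fixed_point : Omega sigma u.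
Proof.
move=> K [[[y Ky] cK sK _] _].
apply: (closed_cylinder (compact_closed full_shift_hausdorff cK)) => N.
have [n Hn] := u_lim N; exists (iter n (subst_biinf sigma) y); last first.
  exact/agree_sym/Hn.
by elim: n {Hn} => //= n IHn; apply: sK; exists (iter n (subst_biinf sigma) y).
Qed.
End Hull.
End ShiftTopology.

Lemma within_continuous_cylinder (R : realType) (A : finType)
    (X : set (full_shift A)) (f : full_shift A -> Cfield R) :
  {within X, continuous f} <->
  forall u, X u -> forall e : Cfield R, 0 < e ->
    exists N, forall y, X y -> agree N u y -> `|f u - f y| < e.
Proof.
rewrite subspace_continuousP; split=> Hf u Xu.
  move=> e e0; have /cvgrPdist_lt/(_ e e0) := Hf u Xu.
  by move=> /nbhs_cylinderP [N HN]; exists N => y Xy Hy; exact: HN.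
apply/cvgrPdist_lt => e e0; have [N HN] := Hf u Xu e e0.
by apply/nbhs_cylinderP; exists N => y Hy Xy; exact: HN.
Qed.

(** * The map t |-> exp(2 i pi t) *)

Section Circle.
Variable R : realType.
Implicit Types (s t : R).

Lemma Cfield_gt0 (e : Cfield R) : 0 < e -> exists2 r : R, 0 < r & e = r%:C.
Proof.
case: e => a b; rewrite ltcE /= => /andP[/eqP b0 a0].
by exists a => [|]; [exact: a0 | rewrite b0].
Qed.

Lemma exp_2ipi0 : exp_2ipi 0 = 1 :> Cfield R.
Proof. by rewrite /exp_2ipi mulr0 cos0 sin0. Qed.

Lemma exp_2ipiD s t : exp_2ipi (s + t) = exp_2ipi s * exp_2ipi t.
Proof.
rewrite /exp_2ipi mulrDr cosD sinD; apply/eqP; rewrite eq_complex /=.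
by rewrite eqxx /= addrC [X in _ + X]mulrC.
Qed.

Lemma norm_exp_2ipi t : `|exp_2ipi t| = 1.
Proof. by rewrite /exp_2ipi normc_def /= cos2Dsin2 sqrtr1. Qed.

Lemma exp_2ipi_neq0 t : exp_2ipi t != 0.
Proof. by rewrite -normr_gt0 norm_exp_2ipi ltr01. Qed.

Lemma exp_2ipi1 : exp_2ipi 1 = 1 :> Cfield R.
Proof. by rewrite /exp_2ipi mulr1 mulr_natl cos2pi sin2pi. Qed.

Lemma exp_2ipi_nat t n : exp_2ipi (n%:R * t) = exp_2ipi t ^+ n.
Proof.
elim: n => [|n IHn]; first by rewrite mul0r exp_2ipi0.
by rewrite mulrS mulrDl mul1r exp_2ipiD IHn exprS.
Qed.

Lemma exp_2ipi_int (z : int) : exp_2ipi (z%:~R) = 1 :> Cfield R.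
Proof.
case: z => n.
  by rewrite -pmulrn -[n%:R]mulr1 exp_2ipi_nat exp_2ipi1 expr1n.
rewrite NegzE mulrNz; apply: (mulIf (exp_2ipi_neq0 n.+1%:~R)).
rewrite -exp_2ipiD addNr exp_2ipi0 mul1r.
by rewrite -pmulrn -[n.+1%:R]mulr1 exp_2ipi_nat exp_2ipi1 expr1n.
Qed.

Lemma exp_2ipi_dist t :
  `|exp_2ipi t - 1| = (Num.sqrt (2 * (1 - cos (2 * pi * t))))%:C.
Proof.
rewrite normc_def /=; congr (Num.sqrt _)%:C.
have := cos2Dsin2 (2 * pi * t); rewrite subr0; nra.
Qed.

Lemma exp_2ipi_continuous (e : Cfield R) : 0 < e ->
  exists2 d : R, 0 < d & forall s t, `|s - t| < d ->
    `|exp_2ipi s - exp_2ipi t| < e.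
Proof.
move=> /Cfield_gt0[r r0 ->].
have r2 : 0 < r ^+ 2 / 2 by rewrite divr_gt0 // exprn_gt0.
have /cvgrPdist_lt/(_ _ r2) := @continuous_cos R 0.
rewrite cos0 => /nbhs_ballP[d /= d0 Hd].
exists (d / (2 * pi)) => [|s t st].
  by rewrite divr_gt0 // mulr_gt0 // pi_gt0.
have -> : exp_2ipi s - exp_2ipi t = exp_2ipi t * (exp_2ipi (s - t) - 1).
  by rewrite mulrBr mulr1 -exp_2ipiD [t + _]addrC subrK.
rewrite normrM norm_exp_2ipi mul1r exp_2ipi_dist ltcR.
have pi2 : 0 < 2 * pi :> R by rewrite mulr_gt0 // pi_gt0.
have /Hd : ball 0 d (2 * pi * (s - t)).
  rewrite /ball /= sub0r normrN normrM gtr0_norm // mulrC.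
  by rewrite -ltr_pdivlMr.
rewrite /= => H; rewrite -(ltr_pXn2r (n := 2)) ?nnegrE ?sqrtr_ge0 ?ltW //.
rewrite sqr_sqrtr; last by have := cos_le1 (2 * pi * (s - t)); nra.
have := ler_norm (1 - cos (2 * pi * (s - t))); nra.
Qed.

(** After subtraction of the nearest integer, |t| <= 1/2, where the chord from 1
    to exp(2 i pi t) grows with |t|. *)
Lemma exp_2ipi_near1 (e : R) : 0 < e ->
  exists2 d : R, 0 < d & forall t, `|exp_2ipi t - 1| < d%:C ->
    exists z : int, `|t - z%:~R| < e.
Proof.
move=> e0; pose e' := Num.min e (1 / 4).
have e'0 : 0 < e' by rewrite lt_min e0 /=; lra.
have [e'e e'4] : e' <= e /\ e' <= 1 / 4 by split; rewrite ge_min lexx ?orbT.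
have pi0 := pi_gt0 R.
have cpos : 0 < 1 - cos (2 * pi * e').
  rewrite subr_gt0 -[ltRHS]cos0 ltr_cos ?in_itv /= ?lexx; nra.
exists (Num.sqrt (2 * (1 - cos (2 * pi * e')))) => [|t].
  by rewrite sqrtr_gt0 mulr_gt0.
pose z := Num.floor (t + 1 / 2); pose s := t - z%:~R.
have -> : exp_2ipi t = exp_2ipi s.
  by rewrite -[t](subrK z%:~R) exp_2ipiD exp_2ipi_int mulr1.
rewrite exp_2ipi_dist ltcR ltr_sqrt ?mulr_gt0 // => H.
exists z; rewrite -/s; rewrite ltNge; apply/negP => es.
have s2 : `|s| <= 1 / 2.
  have := floor_itv (t + 1 / 2); rewrite -/z intrD ler_norml /s; lra.
suff : cos (2 * pi * s) <= cos (2 * pi * e') by nra.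
rewrite -cos_norm normrM gtr0_norm ?mulr_gt0 //.
rewrite leNgt ltr_cos -?leNgt ?in_itv /=; nra.
Qed.
End Circle.

(** * Bounded sums and continuous coboundaries *)

Section Coboundary.
Variables (R : realType) (A : finType).
Implicit Types (h : A -> R) (y u : int -> A).

Definition norm1 h : R := \sum_a `|h a|.

Lemma norm1_ge0 h : 0 <= norm1 h.
Proof. exact: sumr_ge0. Qed.

Lemma le_norm1 h a : `|h a| <= norm1 h.
Proof. by rewrite /norm1 (bigD1 a) //= lerDl sumr_ge0. Qed.

Lemma norm_weight_bound h (e : R) s : (forall a, `|h a| <= e) ->
  `|weight h s| <= (size s)%:R * e.
Proof.
move=> He; elim: s => [|a s IHs]; first by rewrite /weight big_nil normr0 mul0r.
rewrite /weight big_cons -/(weight h s) /= mulrS mulrDl mul1r.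
by apply: le_trans (ler_normD _ _) _; rewrite lerD.
Qed.

Lemma norm_weight_le h s : `|weight h s| <= (size s)%:R * norm1 h.
Proof. exact/norm_weight_bound/le_norm1. Qed.

Lemma norm_cocycle_le h y k : `|cocycle h y k| <= `|k|%N%:R * norm1 h.
Proof.
have bound (z : nat -> A) n : `|\sum_(i < n) h (z i)| <= n%:R * norm1 h.
  apply: le_trans (ler_norm_sum _ _ _) _.
  rewrite mulr_natl -[X in _ *+ X]card_ord -sumr_const.
  by apply: ler_sum => i _; exact: le_norm1.
by case: k => n /=; [exact: (bound (y \o Posz)) | rewrite normrN; exact: (bound (y \o Negz))].
Qed.

Lemma cocycle_agree (V : zmodType) (h : A -> V) N y y' (k : int) :
  agree N y y' -> - N%:Z <= k <= N%:Z -> cocycle h y k = cocycle h y' k.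
Proof.
move=> H; case: k => n Hn /=; [|congr (- _)]; apply: eq_bigr => i _;
  by congr (h _); apply: H; have := ltn_ord i; lia.
Qed.

Section Bounded.
Variables (sigma : seq A -> seq A) (u : int -> A) (h : A -> R) (C : R).
Hypothesis Hs : substitution sigma.
Hypothesis u_fix : subst_biinf sigma u = u.

Let h_ n a := weight h (iter n sigma [:: a]).

Hypothesis summable : forall N, \sum_(n < N) norm1 (h_ n) <= C.

Let D : nat := \max_a size (sigma [:: a]).

(** The sum of h o sigma^n over a segment of u = sigma(u) is a sum of
    h o sigma^(n+1) over a segment that is no longer, up to part of the image of
    a single letter. *)
Lemma cocycle_desubst n (k : int) : exists2 j : int, (`|j| <= `|k|)%N &
  `|cocycle (h_ n) u k| <= `|cocycle (h_ n.+1) u j| + D%:R * norm1 (h_ n).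
Proof.
have [j [i [lt_i Ek jk]]] := cutpt_cover u k Hs; exists j; first by lia.
rewrite -{1}u_fix Ek cocycle_subst //; last exact: ltnW.
apply: le_trans (ler_normD _ _) _; apply: lerD.
  rewrite le_eqVlt; apply/orP; left; apply/eqP; congr `|cocycle _ u j|.
  apply/funext => a; rewrite /h_ iterSr [RHS]weight_subst //.
  exact: substitution_iter.
apply: le_trans (norm_weight_le _ _) _; apply: (ler_wpM2r (norm1_ge0 _)).
rewrite ler_nat size_take lt_i; apply: leq_trans (ltnW lt_i) _.
exact: (@leq_bigmax _ (fun a => size (sigma [:: a]))).
Qed.

(** Desubstituting n times leaves the boundary terms, whose total is at most D C,
    and a sum of at most |k| values of h o sigma^n, which is at most C for a
    suitable n. *)
Lemma cocycle_bounded k : `|cocycle h u k| <= (D%:R + 1) * C.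
Proof.
have -> : h = h_ 0 by apply/funext => a; rewrite /h_ /weight /= big_seq1.
have C0 : 0 <= C by have := summable 0; rewrite big_ord0.
have iterated n : exists2 j : int, (`|j| <= `|k|)%N &
    `|cocycle (h_ 0) u k| <=
    `|cocycle (h_ n) u j| + D%:R * \sum_(m < n) norm1 (h_ m).
  elim: n => [|n [j jk IHn]]; first by exists k; rewrite ?big_ord0 ?mulr0 ?addr0.
  have [j' j'j Hj'] := cocycle_desubst n j; exists j'; first exact: leq_trans jk.
  by apply: le_trans IHn _; rewrite big_ord_recr mulrDr; lra.
(* the norms of h_ n add up to at most C, so one of the first |k| of them is at
   most C / |k| *)
have [n Hn] : exists n, `|k|%N%:R * norm1 (h_ n) <= C.
  apply: contrapT => /forallNP H.
  have {}H n : C < `|k|%N%:R * norm1 (h_ n) by rewrite ltNge; exact/negP/H.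
  have [K0|K0] := posnP `|k|%N; first by have := H 0%N; rewrite K0 mul0r; lra.
  have : `|k|%N%:R * C < `|k|%N%:R * \sum_(n < `|k|%N) norm1 (h_ n).
    rewrite mulr_sumr mulr_natl -[X in _ *+ X]card_ord -sumr_const.
    apply: ltr_sum => [|n _]; last exact: H.
    by apply/hasP; exists (Ordinal K0); rewrite ?mem_index_enum.
  by rewrite ltr_pM2l ?ltr0n // ltNge summable.
have [j jk] := iterated n; move/le_trans; apply.
rewrite mulrDl addrC mul1r lerD ?ler_wpM2l //.
apply: le_trans (norm_cocycle_le _ _ _) (le_trans _ Hn).
by rewrite ler_wpM2r ?norm1_ge0 // ler_nat.
Qed.
End Bounded.

Section GottschalkHedlund.
Variables (u : int -> A) (h : A -> R) (B : R).
Hypothesis u_rec : forall N, exists L : nat, forall k : int,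
  exists t : int, k <= t <= k + L%:Z /\ agree N (fun i => u (i + t)) u.
Hypothesis u_bounded : forall k, `|cocycle h u k| <= B.

Lemma hull_recurrent N : exists L : nat, forall y, hull u y ->
  exists t : int, 0 <= t <= L%:Z /\ agree N (fun i => y (i + t)) u.
Proof.
have [L HL] := u_rec N; exists L => y Hy.
have [s Hy'] := Hy (N + L)%N; have [t [Ht ut]] := HL s.
exists (t - s); split; first by lia.
move=> k Hk; rewrite Hy'; last by lia.
by rewrite -addrA subrK; apply: ut.
Qed.

(** A difference of two sums over y only involves a window of y, which occurs
    in u. *)
Lemma hull_oscillation y b (k l : int) : hull u y ->
  (forall k l, cocycle h u k - cocycle h u l <= b) ->
  cocycle h y k - cocycle h y l <= b.
Proof.
move=> Hy Hb; have [t Ht] := Hy (maxn `|k| `|l|).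
rewrite (cocycle_agree _ Ht); last by lia.
rewrite (cocycle_agree (k := l) _ Ht); last by lia.
by rewrite !cocycle_shift opprB addrA subrK.
Qed.

Lemma exists_lub (f : int -> R) b : (forall k, f k <= b) ->
  exists s, (forall k, f k <= s) /\ forall c, (forall k, f k <= c) -> s <= c.
Proof.
move=> Hb; have ne : range f !=set0 by exists (f 0), 0.
exists (sup (range f)); split=> [k|c Hc].
  by apply: ub_le_sup; [exists b => _ [i _ <-] | exists k].
by apply: ge_sup => // _ [i _ <-].
Qed.

(** F y is the supremum of the sums of y over all k. A window of u whose
    oscillation is within e of the least upper bound of all oscillations occurs
    in each y at bounded distance of the origin; no sum of y can exceed the
    largest one on that window by more than e. So F is determined up to e by
    finitely many letters of y, that is, F is continuous. *)
Lemma Gottschalk_Hedlund : exists F : (int -> A) -> R,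
  (forall y, hull u y -> F (fun k => y (k + 1)) = F y - h (y 0)) /\
  forall e, 0 < e -> exists N, forall y y', hull u y -> hull u y' ->
    agree N y y' -> `|F y - F y'| <= e.
Proof.
have diff_bound k l : cocycle h u k - cocycle h u l <= B + B.
  have := u_bounded k; have := u_bounded l; rewrite !ler_norml; lra.
have F_ex y : exists s, hull u y -> (forall k, cocycle h y k <= s) /\
    forall c, (forall k, cocycle h y k <= c) -> s <= c.
  have [Hy|nHy] := pselect (hull u y); last by exists 0.
  have Hb k : cocycle h y k <= B + B.
    by have := hull_oscillation k 0 Hy diff_bound; rewrite cocycle0 subr0.
  by have [s Hs] := exists_lub Hb; exists s.
have [F HF] := choice F_ex; exists F; split.
  move=> y Hy; have Hy1 : hull u (fun k => y (k + 1)).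
    move=> N; have [t Ht] := Hy N.+1; exists (t + 1) => k Hk.
    by rewrite Ht ?addrA 1?(addrAC k) //; lia.
  have [ub1 lub1] := HF _ Hy; have [ub2 lub2] := HF _ Hy1.
  have c1 : cocycle h y 1 = h (y 0) by rewrite -(add0r 1) cocycleS cocycle0 add0r.
  apply/le_anti/andP; split.
    by apply: lub2 => k; rewrite cocycle_shift c1 lerB.
  rewrite lerBlDr; apply: lub1 => k; have := ub2 (k - 1).
  by rewrite cocycle_shift c1 subrK lerBlDr.
pose osc (p : int * int) := cocycle h u p.1 - cocycle h u p.2.
have osc_ne : range osc !=set0 by exists (osc (0, 0)), (0, 0).
have osc_ub : has_ubound (range osc) by exists (B + B) => _ [p _ <-]; exact: diff_bound.
have oscle k l : cocycle h u k - cocycle h u l <= sup (range osc).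
  by apply: ub_le_sup => //; exists (k, l).
move=> e e0; have [_ [[k l] _ <-] /= Hkl] := sup_adherent e0 (conj osc_ne osc_ub).
pose N := maxn `|k| `|l|; have [L HL] := hull_recurrent N.
exists (N + L)%N.
(* a point whose orbit passes near u at time t has its largest Birkhoff sum at
   time k + t, up to e *)
have near y (t : int) : hull u y -> agree N (fun i => y (i + t)) u ->
    cocycle h y (k + t) <= F y <= cocycle h y (k + t) + e.
  move=> Hy Ht; have [ub lub] := HF y Hy; rewrite ub /=; apply: lub => i.
  have := hull_oscillation i (l + t) Hy oscle; move: Hkl; rewrite /osc /=.
  rewrite -(cocycle_agree (k := k) h Ht); last by lia.
  rewrite -(cocycle_agree (k := l) h Ht); last by lia.
  rewrite !cocycle_shift; lra.
move=> y y' Hy Hy' yy'; have [t [Ht yt]] := HL y Hy.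
have y't : agree N (fun i => y' (i + t)) u.
  by apply: agree_trans yt => i Hi; rewrite yy' //; lia.
have := near y t Hy yt; have := near y' t Hy' y't.
rewrite (cocycle_agree (k := k + t) h yy'); last by lia.
rewrite ler_norml; lra.
Qed.
End GottschalkHedlund.

(** The sums of h over y are those of alpha modulo 1, as w takes integer
    values: exp(- 2 i pi F) turns the coboundary equation for h into the
    eigenfunction equation for exp(2 i pi alpha). *)
Lemma eigenvalue_of_summable sigma (alpha : R) (h : A -> R) (w : A -> int) C :
  substitution sigma -> primitive_subst sigma -> proper_subst sigma ->
  (forall a, h a = alpha - (w a)%:~R) ->
  (forall N, \sum_(n < N) norm1 (fun a => weight h (iter n sigma [:: a])) <= C) ->
  dynamical_eigenvalue (Omega sigma) (exp_2ipi alpha).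
Proof.
move=> Hs Hp Hpr Hh HC; split; first exact: norm_exp_2ipi.
have [u [u_fix u_lim]] := biinf_fixed_point Hs Hp Hpr.
have [F [Fshift Fcont]] := Gottschalk_Hedlund
  (fixed_point_recurrent Hs u_fix u_lim) (cocycle_bounded Hs u_fix HC).
have sub := Omega_hull Hs u_fix.
exists (fun y => exp_2ipi (- F y)); split.
- apply/within_continuous_cylinder => y /sub Hy e e0.
  have [d d0 Hd] := exp_2ipi_continuous e0.
  have d2 : 0 < d / 2 by rewrite divr_gt0.
  have [N HN] := Fcont _ d2; exists N => y' /sub Hy' yy'; apply: Hd.
  rewrite -opprD normrN; apply: le_lt_trans (HN _ _ Hy Hy' yy') _; lra.
- by move=> y _; exact: norm_exp_2ipi.
- move=> y /sub Hy; rewrite /shiftZ Fshift // Hh.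
  rewrite (_ : - _ = alpha + - F y + (- w (y 0))%:~R); last by rewrite mulrNz; ring.
  by rewrite exp_2ipiD exp_2ipi_int mulr1 exp_2ipiD.
Qed.
End Coboundary.

(** * Consequences of a continuous eigenfunction *)

Section Necessity.
Variables (R : realType) (A : finType) (sigma : seq A -> seq A) (alpha : R).
Hypotheses (Hs : substitution sigma) (Hp : primitive_subst sigma).
Hypothesis Hpr : proper_subst sigma.

Let len n a : R := (size (iter n sigma [:: a]))%:R.

(** If y_0 = a then sigma^m(S y) is sigma^m(y) shifted by |sigma^m(a)|, while both
    sequences approach u; so the eigenfunction f varies little between them. *)
Lemma lengths_near_int : dynamical_eigenvalue (Omega sigma) (exp_2ipi alpha) ->
  forall e : R, 0 < e -> exists n, forall m a, (n <= m)%N ->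
    exists z : int, `|alpha * len m a - z%:~R| < e.
Proof.
move=> [_ [f [/within_continuous_cylinder fcont f1 fS]]] e e0.
have [d d0 Hd] := exp_2ipi_near1 e0.
have [u [u_fix u_lim]] := biinf_fixed_point Hs Hp Hpr.
have Ou : Omega sigma u by exact: Omega_fixed_point.
have fSn n y : Omega sigma y -> Omega sigma (fun k => y (k + n%:Z)) /\
    f (fun k => y (k + n%:Z)) = exp_2ipi (n%:R * alpha) * f y.
  move=> Oy; elim: n => [|n [IH1 IH2]].
    rewrite mul0r exp_2ipi0 mul1r.
    by rewrite (_ : (fun k => _) = y) //; apply/funext => k; rewrite addr0.
  have -> : (fun k => y (k + n.+1%:Z)) = shiftZ (fun k => y (k + n%:Z)).
    by apply/funext => k; rewrite /shiftZ; congr y; lia.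
  split; first exact: Omega_shift.
  by rewrite fS // IH2 mulrA mulrS mulrDl mul1r exp_2ipiD.
have On m y : Omega sigma y -> Omega sigma (iter m (subst_biinf sigma) y).
  by move=> Oy; elim: m => //= m; exact: Omega_subst.
have d2 : 0 < (d / 2)%:C by rewrite ltcR divr_gt0.
have [N HN] := fcont u Ou _ d2; have [n Hn] := u_lim N.
exists n => m a nm; have [k Ek] := fixed_point_letter Hs Hp u_fix a.
have [Oy _] := fSn k u Ou; set y := (fun _ => _) in Oy.
have [Oy' _] := fSn 1%N y Oy.
pose z := iter m (subst_biinf sigma) y.
pose z' := iter m (subst_biinf sigma) (fun k => y (k + 1%N%:Z)).
have Ez' : z' = fun k => z (k + (size (iter m sigma [:: a]))%:Z).
  apply/funext => i; have Ht := substitution_iter m Hs.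
  by rewrite /z' /z -!subst_biinf_iter // subst_biinf_shift // cutpt1 /y add0r Ek.
have [_] := fSn (size (iter m sigma [:: a])) z (On m y Oy); rewrite -Ez' => fz'.
apply: Hd; rewrite mulrC.
have -> : `|exp_2ipi (len m a * alpha) - 1| = `|f z' - f z|.
  by rewrite fz' -{2}[f z]mul1r -mulrBl normrM f1 ?mulr1 //; exact: On.
have -> : d%:C = (d / 2)%:C + (d / 2)%:C by rewrite -rmorphD /= -splitr.
apply: le_lt_trans (ler_distD (f u) _ _) _; rewrite ltrD //.
  by rewrite distrC; apply: HN; [exact: On | exact/agree_sym/Hn].
by apply: HN; [exact: On | exact/agree_sym/Hn].
Qed.

Lemma floor_near (t e : R) (z : int) : `|t - z%:~R| < e -> e <= 1 / 2 ->
  Num.floor (t + 1 / 2) = z.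
Proof. by move=> tz e2; apply: floor_def; rewrite intrD; move: tz; rewrite ltr_norml; lra. Qed.

Lemma weightB (V : zmodType) (h g : A -> V) s :
  weight (fun a => h a - g a) s = weight h s - weight g s.
Proof. by rewrite /weight sumrB. Qed.

Lemma intr_weight (z : A -> int) s :
  (weight z s)%:~R = weight (fun a => (z a)%:~R : R) s.
Proof. by rewrite /weight rmorph_sum. Qed.

Lemma weight_len n s :
  weight (fun a => alpha * len n a) s = alpha * (size (iter n sigma s))%:R.
Proof.
rewrite /weight -mulr_sumr; congr (_ * _).
by have := weight_letter_size s (substitution_iter n Hs) => /(congr1 (intr : int -> R));
   rewrite intr_weight -pmulrn.
Qed.

(** z is the integer row closest to alpha e M^n0, with n0 so large that all
    further roundings are obtained from it by applying M. *)
Lemma length_defect_decay :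
  dynamical_eigenvalue (Omega sigma) (exp_2ipi alpha) ->
  exists n0 (z : A -> int), forall e : R, 0 < e -> exists n, forall m a,
    (n <= m)%N ->
    `|weight (fun b => alpha * len n0 b - (z b)%:~R) (iter m sigma [:: a])| < e.
Proof.
move=> /lengths_near_int near.
pose z n a : int := Num.floor (alpha * len n a + 1 / 2).
have zcv e : 0 < e -> exists n, forall m a, (n <= m)%N ->
    `|alpha * len m a - (z m a)%:~R| < e.
  move=> e0; have e'0 : 0 < Num.min e (1 / 2) by rewrite lt_min e0 /=; lra.
  have [n Hn] := near _ e'0; exists n => m a nm; have [z' Hz'] := Hn m a nm.
  rewrite /z (floor_near Hz') ?ge_min ?lexx ?orbT //.
  by apply: lt_le_trans Hz' _; rewrite ge_min lexx.
pose D : nat := \max_a size (sigma [:: a]).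
have D0 : 0 < (D%:R + 1)^-1 :> R by rewrite invr_gt0 ltr_wpDl.
have [n0 Hn0] := zcv _ D0.
(* successive roundings are compatible with sigma because they differ from it by
   an integer smaller than 1 *)
have step m a : (n0 <= m)%N -> z m.+1 a = weight (z m) (sigma [:: a]).
  move=> nm; apply/eqP; rewrite -subr_eq0.
  suff : `|(z m.+1 a - weight (z m) (sigma [:: a]))%:~R| < 1 :> R.
    by rewrite -intr_norm (ltr_int R _ 1); lia.
  rewrite intrB intr_weight.
  have -> : (z m.+1 a)%:~R - weight (fun b => (z m b)%:~R) (sigma [:: a]) =
     weight (fun b => alpha * len m b - (z m b)%:~R) (sigma [:: a]) -
     (alpha * len m.+1 a - (z m.+1 a)%:~R) :> R.
    by rewrite weightB weight_len /len iterSr; ring.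
  apply: le_lt_trans (ler_normB _ _) _.
  have := Hn0 _ a (leqW nm); set r := `|_ - (z m.+1 a)%:~R|; set q := `|_|.
  have : q <= D%:R * (D%:R + 1)^-1.
    apply: le_trans (norm_weight_bound _ (fun b => ltW (Hn0 m b nm))) _.
    apply: (ler_wpM2r (ltW D0)); rewrite ler_nat.
    exact: (@leq_bigmax _ (fun a => size (sigma [:: a]))).
  have : (D%:R + 1) * (D%:R + 1)^-1 = 1 :> R by rewrite mulfV // gt_eqF // ltr_wpDl.
  by rewrite mulrDl mul1r; lra.
have stepn m a : z (m + n0)%N a = weight (z n0) (iter m sigma [:: a]).
  elim: m a => [|m IHm] a; first by rewrite /weight big_seq1.
  rewrite addSn step ?leq_addl // iterSr [RHS]weight_subst; last exact: substitution_iter.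
  by congr weight; apply/funext => b; exact: IHm.
exists n0, (z n0) => e e0; have [n Hn] := zcv e e0; exists n => m a nm.
rewrite weightB weight_len -intr_weight -stepn -iterD addnC.
by apply: Hn; rewrite (leq_trans nm) // leq_addr.
Qed.
End Necessity.

(** * Decay of row vectors under powers of a matrix *)

Lemma char_poly_split (R : realType) n (M : 'M[Cfield R]_n) :
  char_poly M = \prod_(z <- spectrum M) ('X - z%:P).
Proof.
rewrite /spectrum; case: closed_field_poly_normal => s /= {1}->.
by rewrite (monicP (char_poly_monic M)) scale1r.
Qed.

(** d is the multiplicity of the eigenvalue 0, and the coefficient of degree d
    is, up to sign, the product of the other eigenvalues. *)
Lemma pseudo_unimodular_coef (R : realType) n (M : 'M[Cfield R]_n) :
  pseudo_unimodular M -> exists d,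
    (forall i, (i < d)%N -> (char_poly M)`_i = 0) /\
    (char_poly M)`_d ^+ 2 = 1.
Proof.
move=> HM; pose q := \prod_(z <- spectrum M | z != 0) ('X - z%:P).
pose d := count (pred1 0) (spectrum M).
have E : char_poly M = q * 'X^d.
  rewrite char_poly_split (bigID (fun z => z == 0)) /= mulrC; congr (_ * _).
  rewrite (eq_bigr (fun=> 'X)) => [|z /eqP->]; last by rewrite subr0.
  by rewrite big_const_seq -/d; elim: d => //= d ->; rewrite exprS.
have q0 : q`_0 ^+ 2 = 1.
  rewrite -horner_coef0 horner_prod -prodrXl.
  under eq_bigr do rewrite hornerXsubC sub0r sqrrN.
  by rewrite prodrXl; case: HM => ->; rewrite ?sqrrN expr1n.
exists d; split=> [i lt_id|]; first by rewrite E coefMXn lt_id.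
by rewrite E coefMXn ltnn subnn.
Qed.

(** M acts invertibly on the image of M^d. By Cayley-Hamilton
    c M^d + T(M) M^(d+1) = 0 with c = 1 or -1 the coefficient of degree d, so
    that Q = - c T(M) is an inverse with integer entries. *)
Lemma pseudo_unimodular_absorb (R : realType) n (M : 'M[int]_n) :
  pseudo_unimodular (map_mx intr M : 'M[Cfield R]_n) ->
  exists d (Q : 'M[int]_n), forall k, M ^+ d = Q ^+ k *m M ^+ (d + k).
Proof.
case: n M => [|n] M HM.
  by exists 0%N, 0 => k; rewrite [LHS]flatmx0 [RHS]flatmx0.
have [d []] := pseudo_unimodular_coef HM; rewrite -map_char_poly => P0 Pd.
set P := char_poly M in P0 Pd.
have {}P0 i : (i < d)%N -> P`_i = 0.
  by move/P0/eqP; rewrite coef_map /= intr_eq0 => /eqP.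
have {}Pd : P`_d ^+ 2 = 1.
  apply: (@intr_inj (Cfield R)); rewrite rmorphXn /=.
  by move: Pd; rewrite coef_map.
pose T := drop_poly d.+1 P.
have EP : P = ((P`_d)%:P + T * 'X) * 'X^d.
  apply/polyP => i; rewrite coefMXn; case: ltnP => [/P0 //|le_di].
  rewrite coefD coefC coefMX coef_drop_poly.
  have [E0|nz] := eqVneq (i - d)%N 0%N.
    by rewrite addr0; congr (P`_ _); lia.
  by rewrite add0r; congr (P`_ _); lia.
pose Q := - (P`_d *: horner_mx M T).
have EM : M ^+ d = Q * M ^+ d.+1.
  have := Cayley_Hamilton M; rewrite -/P EP.
  rewrite rmorphM rmorphD rmorphM rmorphXn /= horner_mx_C horner_mx_X.
  rewrite mulrDl -mulrA -exprS => /eqP; rewrite addr_eq0 => /eqP H.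
  rewrite /Q mulNr -scalerAl -scalerN -H -mul_scalar_mx.
  by rewrite [_ *m _]mulmxA -scalar_mxM -expr2 Pd mul1mx.
exists d, Q; elim=> [|k IHk]; first by rewrite expr0 addn0 mul1mx.
rewrite exprS addnS exprSr -[_ *m _]/(Q * Q ^+ k * (M ^+ (d + k) * M)).
by rewrite -mulrA [_ * (_ * M)]mulrA -[_ ^+ k * _]IHk -exprSr.
Qed.

(** By induction on k, the sequence x M^m v is geometric of ratio gamma; it tends
    to 0 only if it vanishes. The induction hypothesis is needed for all the rows
    x M^m, hence the quantification over x. *)
Lemma decay_kills (F : numFieldType) n (M : 'M[F]_n) (x : 'rV[F]_n)
    (gamma : F) (v : 'cV[F]_n) k :
  (forall e, 0 < e -> exists N, forall m i, (N <= m)%N ->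
     `|(x *m M ^+ m) 0 i| < e) ->
  1 <= `|gamma| -> (M - gamma%:M) ^+ k *m v = 0 -> x *m v = 0.
Proof.
move=> + g1; elim: k v x => [|k IHk] v x Hx; first by rewrite expr0 mul1mx => ->; rewrite mulmx0.
rewrite exprSr -mulmxA => Hv.
have E m : x *m M ^+ m *m v = gamma ^+ m *: (x *m v).
  elim: m => [|m IHm]; first by rewrite !expr0 mulmx1 scale1r.
  have : x *m M ^+ m *m ((M - gamma%:M) *m v) = 0.
    apply: IHk Hv => e /Hx[N HN]; exists N => m' i Hm'.
    by rewrite -mulmxA -[M ^+ m *m _]exprD; apply: HN; exact: leq_trans Hm' (leq_addl _ _).
  rewrite mulmxBl mulmxBr mul_scalar_mx -scalemxAr IHm scalerA -exprS.
  by rewrite mulmxA -[x *m _ *m M]mulmxA -[_ ^+ m *m M]exprSr => /eqP; rewrite subr_eq0 => /eqP.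
apply/matrixP => i j; rewrite !ord1 [RHS]mxE; apply/eqP; rewrite -normr_le0.
pose V := 1 + \sum_i `|v i 0|.
have V0 : 0 < V by rewrite ltr_pwDl // sumr_ge0.
apply/ler_addgt0Pr => e e0; rewrite add0r.
have eV : 0 < e / V by rewrite divr_gt0.
have [N HN] := Hx _ eV.
have le_N : `|(x *m v) 0 0| <= `|(x *m M ^+ N *m v) 0 0|.
  by rewrite E [X in _ <= `|X|]mxE normrM normrX ler_peMl // exprn_ege1.
apply: le_trans le_N _; rewrite mxE; apply: le_trans (ler_norm_sum _ _ _) _.
have -> : e = e / V * V by rewrite divfK // gt_eqF.
rewrite /V mulrDr mulr1 ler_wpDl ?(ltW eV) // mulr_sumr.
apply: ler_sum => i' _; rewrite normrM ler_wpM2r //.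
exact/ltW/HN.
Qed.

Definition rnorm1 (F : numDomainType) n (x : 'rV[F]_n) : F := \sum_i `|x 0 i|.

Lemma rnorm1_ge0 (F : numDomainType) n (x : 'rV[F]_n) : 0 <= rnorm1 x.
Proof. exact: sumr_ge0. Qed.

Lemma rnorm1D (F : numDomainType) n (x y : 'rV[F]_n) : rnorm1 (x + y) <= rnorm1 x + rnorm1 y.
Proof.
rewrite /rnorm1 -big_split /=; apply: ler_sum => i _; rewrite mxE.
exact: ler_normD.
Qed.

Lemma rnorm1Z (F : numDomainType) n a (x : 'rV[F]_n) : rnorm1 (a *: x) = `|a| * rnorm1 x.
Proof.
by rewrite /rnorm1 mulr_sumr; apply: eq_bigr => i _; rewrite mxE normrM.
Qed.

Section Summable.
Variables (F : numClosedFieldType) (n : nat) (M : 'M[F]_n.+1).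
Implicit Types (x : 'rV[F]_n.+1) (p q : {poly F}).

Let ann x p := x *m horner_mx M p = 0.

Lemma ann_mulr x p q : ann x p -> ann x (p * q).
Proof. by rewrite /ann rmorphM => xp; rewrite mulmxA xp mul0mx. Qed.

(** The polynomials p with x p(M) = 0 form an ideal; p generates it. *)
Lemma annihilator x : exists2 p, p != 0 & forall q, ann x q <-> p %| q.
Proof.
pose P k := `[< exists p, [/\ p != 0, ann x p & size p = k] >].
have exP : exists k, P k.
  exists (size (char_poly M)); apply/asboolP; exists (char_poly M); split=> //.
    exact/monic_neq0/char_poly_monic.
  by rewrite /ann Cayley_Hamilton mulmx0.
case: (ex_minnP exP) => k /asboolP[p [p0 xp sp]] min_k.
exists p => // q; split=> [xq|/dvdpP[r ->]]; last by rewrite mulrC; exact: ann_mulr.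
apply: contraT; rewrite /dvdp => qp0.
have : P (size (q %% p)).
  apply/asboolP; exists (q %% p); split=> //.
  have -> : q %% p = q - p * (q %/ p) by rewrite {2}(divp_eq q p) mulrC addrAC subrr add0r.
  by rewrite /ann rmorphB /= mulmxBr xq (ann_mulr _ xp) subrr.
by move/min_k; rewrite -sp leqNgt ltn_modp p0.
Qed.

(** With y = x (M - r), one has x M^(m+1) = r x M^m + y M^m: since |r| < 1, the
    norms of the x M^m have a bounded sum when those of the y M^m do. *)
Lemma contracting_summable (rs : seq F) x :
  (forall r, r \in rs -> `|r| < 1) ->
  ann x (\prod_(r <- rs) ('X - r%:P)) ->
  exists C : F, forall N, \sum_(m < N) rnorm1 (x *m M ^+ m) <= C.
Proof.
elim: rs x => [|r rs IHrs] x Hrs.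
  rewrite big_nil /ann rmorph1 mulmx1 => ->; exists 0 => N.
  rewrite big1 // => m _; rewrite mul0mx /rnorm1 big1 // => i _.
  by rewrite mxE normr0.
have r1 : `|r| < 1 by apply: Hrs; rewrite mem_head.
have {}Hrs s : s \in rs -> `|s| < 1 by move=> Hs; apply: Hrs; rewrite inE Hs orbT.
rewrite big_cons /ann rmorphM mulmxA /= => /(IHrs _ Hrs)[C HC].
exists ((rnorm1 x + C) / (1 - `|r|)) => N; rewrite ler_pdivlMr ?subr_gt0 //.
have step m : rnorm1 (x *m M ^+ m.+1) <=
    `|r| * rnorm1 (x *m M ^+ m) + rnorm1 (x *m horner_mx M ('X - r%:P) *m M ^+ m).
  rewrite -rnorm1Z; apply: le_trans (rnorm1D _ _).
  rewrite rmorphB /= horner_mx_X horner_mx_C mulmxBr mulmxBl mul_mx_scalar.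
  by rewrite -scalemxAl addrC subrK -[x *m M *m _]mulmxA -[M *m _]exprS.
have grow : \sum_(m < N) rnorm1 (x *m M ^+ m) <=
    \sum_(m < N.+1) rnorm1 (x *m M ^+ m).
  by rewrite [leRHS]big_ord_recr lerDl rnorm1_ge0.
rewrite mulrBr mulr1 lerBlDr; apply: le_trans grow _.
rewrite big_ord_recl expr0 mulmx1 -addrA lerD2l mulrC mulr_sumr.
apply: le_trans (_ : _ <= \sum_(m < N) (`|r| * rnorm1 (x *m M ^+ m) +
    rnorm1 (x *m horner_mx M ('X - r%:P) *m M ^+ m))) _.
  by apply: ler_sum => m _; exact: step.
by rewrite big_split /= [leRHS]addrC lerD2l HC.
Qed.

(** A root g of the minimal polynomial p of x has modulus < 1. Otherwise write
    the characteristic polynomial as (X - g)^k q with q(g) non-zero: the image of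
    q(M) is contained in the kernel of (M - g)^k, which x kills, so x q(M) = 0
    and p divides q, although g is a root of p and not of q. *)
Lemma kills_summable_succ x :
  (forall gamma (v : 'cV_n.+1), root (char_poly M) gamma -> 1 <= `|gamma| ->
    (M - gamma%:M) ^+ mup gamma (char_poly M) *m v = 0 -> x *m v = 0) ->
  exists C : F, forall N, \sum_(m < N) rnorm1 (x *m M ^+ m) <= C.
Proof.
move=> Hx; have [p p0 Hp] := annihilator x.
have pchar : p %| char_poly M by apply/Hp; rewrite /ann Cayley_Hamilton mulmx0.
have char0 : char_poly M != 0 by exact/monic_neq0/char_poly_monic.
have proots g : root p g -> `|g| < 1.
  move=> pg; have cg : root (char_poly M) g by rewrite -dvdp_XsubCl (dvdp_trans _ pchar) ?dvdp_XsubCl.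
  have g_real : `|g| \is Num.real by exact: normr_real.
  rewrite real_ltNge // ?num_real //; apply/negP => g1.
  have : ('X - g%:P) ^+ mup g (char_poly M) %| char_poly M by rewrite -mup_geq.
  case/dvdpP => q Eq.
  have q0 : q != 0 by apply: contra_neq char0; rewrite Eq => ->; rewrite mul0r.
  have qg : ~~ root q g.
    apply/negP; rewrite -dvdp_XsubCl => /dvdpP[s Es].
    have := mup_leq g (mup g (char_poly M)) char0; rewrite leqnn => /esym/negP; apply.
    by apply/dvdpP; exists s; rewrite {1}Eq Es exprS mulrA.
  suff pq : p %| q by move/negP: qg; apply; rewrite -dvdp_XsubCl (dvdp_trans _ pq) ?dvdp_XsubCl.
  apply/Hp; rewrite /ann; apply/matrixP => i j; rewrite [RHS]mxE.
  suff /matrixP/(_ i 0) : col j (x *m horner_mx M q) = 0 by rewrite !mxE.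
  rewrite colE -mulmxA; apply: Hx cg g1 _; rewrite mulmxA.
  suff -> : (M - g%:M) ^+ mup g (char_poly M) *m horner_mx M q = 0 by rewrite mul0mx.
  have <- : horner_mx M (('X - g%:P) ^+ mup g (char_poly M)) =
      (M - g%:M) ^+ mup g (char_poly M).
    by rewrite rmorphXn rmorphB /= horner_mx_X horner_mx_C.
  by have := Cayley_Hamilton M; rewrite {1}Eq mulrC rmorphM.
have [rs Ers] := closed_field_poly_normal p.
have lp : lead_coef p != 0 by rewrite lead_coef_eq0.
apply: (contracting_summable (rs := rs)).
  by move=> r Hr; apply: proots; rewrite Ers rootZ // root_prod_XsubC.
by apply/Hp; rewrite {1}Ers dvdpZl.
Qed.
End Summable.

Lemma kills_summable (F : numClosedFieldType) n (M : 'M[F]_n) (x : 'rV_n) :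
  (forall gamma (v : 'cV_n), root (char_poly M) gamma -> 1 <= `|gamma| ->
    (M - gamma%:M) ^+ mup gamma (char_poly M) *m v = 0 -> x *m v = 0) ->
  exists C : F, forall N, \sum_(m < N) rnorm1 (x *m M ^+ m) <= C.
Proof.
case: n M x => [|n] M x; last exact: kills_summable_succ.
by move=> _; exists 0 => N; rewrite big1 // => m _; rewrite /rnorm1 big_ord0.
Qed.

(** * The equivalence *)

Section Rows.
Variables (K : pzRingType) (A : finType) (sigma : seq A -> seq A).
Hypothesis Hs : substitution sigma.

Definition row_of (h : A -> K) : 'rV[K]_#|A| := \row_i h (enum_val i).

Lemma map_intr_exp n (M : 'M[int]_n) m :
  map_mx (intr : int -> K) (M ^+ m) = map_mx intr M ^+ m.
Proof.
elim: m => [|m IHm]; first by rewrite !expr0 map_mx1.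
by rewrite !exprS map_mxM IHm.
Qed.

Lemma row_of_iter h m :
  row_of h *m map_mx intr (incidence sigma) ^+ m =
  row_of (fun a => weight h (iter m sigma [:: a])).
Proof. by rewrite -map_intr_exp -incidence_iter // row_incidence. Qed.
End Rows.

Section Defect.
Variables (R : realType) (A : finType) (alpha : R) (w : 'rV[int]_#|A|).

Definition defect (a : A) : R := alpha - (w 0 (enum_rank a))%:~R.

(** The row alpha e - w; defect is its real-valued form, as a function of the
    letters. *)
Definition Cdefect : 'rV[Cfield R]_#|A| := row_of (fun a => (defect a)%:C).

Lemma CdefectE : Cdefect = row_of (fun=> alpha%:C) - map_mx intr w.
Proof.
by apply/rowP => i; rewrite !mxE /defect enum_valK rmorphB /= rmorph_int.
Qed.

Lemma Cdefect_mul (v : 'cV[Cfield R]_#|A|) :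
  (Cdefect *m v) 0 0 = alpha%:C * vsum v - (map_mx intr w *m v) 0 0.
Proof.
rewrite !mxE mulr_sumr -sumrB; apply: eq_bigr => i _.
by rewrite !mxE /defect enum_valK rmorphB /= rmorph_int mulrBl.
Qed.

(** Rescaling v reduces to the two cases of sum 1 and sum 0. *)
Lemma Cdefect_kills M gamma (v : 'cV[Cfield R]_#|A|) :
  (forall (gamma : Cfield R) (v : 'cV[Cfield R]_#|A|), 1 <= `|gamma| ->
    generalized_eigenvector M gamma v ->
      (vsum v = 1 -> (map_mx intr w *m v) 0 0 = alpha%:C) /\
      (vsum v = 0 -> (map_mx intr w *m v) 0 0 = 0)) ->
  root (char_poly M) gamma -> 1 <= `|gamma| ->
  (M - gamma%:M) ^+ mup gamma (char_poly M) *m v = 0 -> Cdefect *m v = 0.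
Proof.
move=> Hw rg g1 Hv; have [->|v0] := eqVneq v 0; first exact: mulmx0.
have eg : eigenvalue M gamma by rewrite eigenvalue_root_char.
apply/matrixP => i j; rewrite !ord1 Cdefect_mul [RHS]mxE.
have [s0|s0] := eqVneq (vsum v) 0.
  have [_ ->//] := Hw gamma v g1 (And3 eg v0 Hv).
  by rewrite s0 mulr0 subr0.
have Hv' : generalized_eigenvector M gamma ((vsum v)^-1 *: v).
  split=> //; first by rewrite scaler_eq0 invr_eq0 negb_or s0.
  by rewrite -scalemxAr Hv scaler0.
have [/(_ _) + _] := Hw gamma _ g1 Hv'.
rewrite -scalemxAr mxE => H; rewrite -H.
  by rewrite mulrAC mulVf // mul1r subrr.
by rewrite /vsum; under eq_bigr do rewrite mxE; rewrite -mulr_sumr mulVf.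
Qed.
End Defect.

Lemma weightC (R : realType) (A : finType) (h : A -> R) s :
  weight (fun a => (h a)%:C : Cfield R) s = (weight h s)%:C.
Proof. by rewrite /weight rmorph_sum. Qed.

Lemma normCR (R : realType) (t : R) : `|t%:C : Cfield R| = `|t|%:C.
Proof. by rewrite normc_def /= expr0n addr0 sqrtr_sqr. Qed.

Section Assembly.
Variables (R : realType) (A : finType) (sigma : seq A -> seq A) (alpha : R).
Hypothesis Hs : substitution sigma.

Lemma defect_summable w :
  (forall (gamma : Cfield R) (v : 'cV[Cfield R]_#|A|), 1 <= `|gamma| ->
    generalized_eigenvector (Cincidence R sigma) gamma v ->
      (vsum v = 1 -> (map_mx intr w *m v) 0 0 = alpha%:C) /\
      (vsum v = 0 -> (map_mx intr w *m v) 0 0 = 0)) ->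
  exists C, forall N, \sum_(n < N)
    norm1 (fun a => weight (defect alpha w) (iter n sigma [:: a])) <= C.
Proof.
move=> /Cdefect_kills Hw; have [C HC] := kills_summable Hw.
exists (complex.Re C) => N; have := HC N.
have -> : \sum_(m < N) rnorm1 (Cdefect alpha w *m Cincidence R sigma ^+ m) =
  (\sum_(n < N) norm1 (fun a => weight (defect alpha w) (iter n sigma [:: a])))%:C.
  rewrite rmorph_sum; apply: eq_bigr => m _; rewrite row_of_iter //.
  rewrite /rnorm1 /norm1 [in RHS]sum_enum_val rmorph_sum; apply: eq_bigr => i _.
  by rewrite mxE weightC normCR.
by rewrite lecE => /andP[].
Qed.

(** Choose w with w M^(d + n0) = z M^d: then x M^(d + n0) is the image under M^d of
    the defect alpha e M^n0 - z, which decays. *)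
Lemma defect_decay : pseudo_unimodular (Cincidence R sigma) ->
  forall n0 (z : A -> int),
  (forall e : R, 0 < e -> exists n, forall m a, (n <= m)%N ->
    `|weight (fun b => alpha * (size (iter n0 sigma [:: b]))%:R - (z b)%:~R)
       (iter m sigma [:: a])| < e) ->
  exists w, forall e : Cfield R, 0 < e -> exists N, forall m i, (N <= m)%N ->
    `|(Cdefect alpha w *m Cincidence R sigma ^+ m) 0 i| < e.
Proof.
move=> /pseudo_unimodular_absorb[d [Q HQ]] n0 z Hz.
exists (row_of z *m Q ^+ n0) => _ /Cfield_gt0[e e0 ->].
have [n Hn] := Hz e e0; exists (n + (d + n0))%N => m i Hm.
pose x0 a := alpha * (size (iter n0 sigma [:: a]))%:R - (z a)%:~R.
set w := row_of z *m _.
have E : Cdefect alpha w *m Cincidence R sigma ^+ (d + n0) =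
   row_of (fun a => (x0 a)%:C) *m Cincidence R sigma ^+ d.
  rewrite CdefectE.
  have -> : row_of (fun a => (x0 a)%:C : Cfield R) =
      row_of (fun=> alpha%:C) *m Cincidence R sigma ^+ n0 - map_mx intr (row_of z).
    rewrite row_of_iter //; apply/rowP => j.
    rewrite !mxE /x0 rmorphB /= rmorph_int; congr (_ - _).
    by rewrite weightC /weight big_const_seq count_predT iter_addr_0 mulr_natr.
  rewrite !mulmxBl; congr (_ - _).
    by rewrite -mulmxA -[_ ^+ n0 *m _]exprD addnC.
  by rewrite -!map_intr_exp -!map_mxM -mulmxA -HQ.
have -> : m = ((d + n0) + (m - (d + n0)))%N by lia.
have {}Hn := Hn (d + (m - (d + n0)))%N (enum_val i).
rewrite exprD mulmxA E -mulmxA -[_ ^+ d *m _]exprD row_of_iter // mxE weightC.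
by rewrite normCR ltcR; apply: Hn; lia.
Qed.
End Assembly.

Theorem theorem1p5 (R : realType) (A : finType) (sigma : seq A -> seq A)
    (alpha : R) :
  substitution sigma -> primitive_subst sigma -> proper_subst sigma ->
  pseudo_unimodular (Cincidence R sigma) ->
  dynamical_eigenvalue (Omega sigma) (exp_2ipi alpha) <->
  exists w : 'rV[int]_#|A|,
    forall (gamma : Cfield R) (v : 'cV[Cfield R]_#|A|),
      1 <= `|gamma| ->
      generalized_eigenvector (Cincidence R sigma) gamma v ->
      (vsum v = 1 -> (map_mx intr w *m v) 0 0 = alpha%:C) /\
      (vsum v = 0 -> (map_mx intr w *m v) 0 0 = 0).
Proof.
move=> Hs Hp Hpr Hpu; split.
  move=> /(length_defect_decay Hs Hp Hpr)[n0 [z Hz]].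
  have [w Hw] := defect_decay Hs Hpu Hz; exists w => gamma v g1 [_ _ Hv].
  have /matrixP/(_ 0 0) := decay_kills Hw g1 Hv.
  rewrite Cdefect_mul [RHS]mxE => /eqP; rewrite subr_eq0 => /eqP Ew.
  by split=> Hv1; rewrite -Ew Hv1 ?mulr1 ?mulr0.
move=> [w /(defect_summable Hs)[C HC]].
exact: (eigenvalue_of_summable (w := fun a => w 0 (enum_rank a)) Hs Hp Hpr _ HC).
Qed.
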